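(* A real $x$ is left-c.e. random if and only if $x$ is 2-random.
   Context: Reals are elements of $[0,1]$, identified with elements of $2^\omega$ via binary expansion; $\mu$ is Lebesgue measure. A real $a$ is left-c.e. if there is a computable nondecreasing sequence of rationals converging to $a$. A left-c.e. test is a sequence $\{V_n=\bigcup_{i}[a_i^n,b_i^n]\}_{n\in\omega}$ ($i$ ranging over $\omega$) such that $a_i^n$ and $b_i^n$ are left-c.e. reals uniformly in $i$ and $n$, $a_i^n\le b_i^n$, and $\mu(V_n)\le 2^{-n}$ for all $n$. A real passes the test if it is not in $\bigcap_n V_n$; a real is left-c.e. random if it passes all left-c.e. tests. A real $x$ is 2-random if it is $\emptyset'$-random, i.e. Martin-Löf random relative to $\emptyset'$ (equivalently, there is a constant $c$ with $K^{\emptyset'}(x\upharpoonright n)\ge n-c$ for all $n$, where $K^{\emptyset'}$ is prefix-free complexity relative to $\emptyset'$). *)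

(* Defs.v *)
From HB Require Import structures.
From mathcomp Require Import all_boot all_order all_algebra.
From mathcomp Require Import all_classical all_reals all_analysis.
From Stdlib Require Cantor.
Set Implicit Arguments.
Unset Strict Implicit.
Unset Printing Implicit Defensive.
Import Order.TTheory GRing.Theory Num.Theory numFieldNormedType.Exports.
Local Open Scope classical_set_scope.
Local Open Scope ring_scope.

(** * Partial recursive functions with an oracle *)

Definition pair_nat (m n : nat) : nat := Cantor.to_nat (m, n).
Definition fst_nat (n : nat) : nat := (Cantor.of_nat n).1.
Definition snd_nat (n : nat) : nat := (Cantor.of_nat n).2.

(* Programs for unary partial functions on [nat]; several arguments are passed
   through the Cantor pairing. *)
Inductive prog : Type :=
| Zero | Succ | Fst | Snd | Oracle
| Pair of prog & prog
| Comp of prog & prog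
| Prec of prog & prog
| Mu of prog.

(* [eval_prog A c n m]: program [c] with oracle [A] halts on input [n] with output
   [m].  On input <a, k>, [Prec f g] computes h(a, k), where h(a, 0) = f a and
   h(a, j.+1) = g <a, <j, h(a, j)>>.  On input [n], [Mu f] computes the least
   [m] with f <n, m> = 0, provided f <n, i> is defined for all i < m. *)
Fixpoint eval_prog (A : set nat) (c : prog) (n m : nat) {struct c} : Prop :=
  match c with
  | Zero => m = 0%N
  | Succ => m = n.+1
  | Fst => m = fst_nat n
  | Snd => m = snd_nat n
  | Oracle => m = nat_of_bool (n \in A)
  | Pair f g => exists u v, [/\ eval_prog A f n u, eval_prog A g n v & m = pair_nat u v]
  | Comp f g => exists2 u, eval_prog A g n u & eval_prog A f u m
  | Prec f g =>
      (fix rec (k r : nat) {struct k} : Prop :=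
         match k with
         | 0 => eval_prog A f (fst_nat n) r
         | j.+1 => exists2 s, rec j s &
                     eval_prog A g (pair_nat (fst_nat n) (pair_nat j s)) r
         end) (snd_nat n) m
  | Mu f => eval_prog A f (pair_nat n m) 0 /\
            forall i, (i < m)%N -> exists v, eval_prog A f (pair_nat n i) v.+1
  end.

Definition halts (A : set nat) (c : prog) (n : nat) : Prop :=
  exists m, eval_prog A c n m.

(* Gödel numbering: the first component of the pair tags the constructor. *)
Fixpoint godel (c : prog) : nat :=
  match c with
  | Zero => pair_nat 0 0
  | Succ => pair_nat 0 1
  | Fst => pair_nat 0 2
  | Snd => pair_nat 0 3
  | Oracle => pair_nat 0 4
  | Pair f g => pair_nat 1 (pair_nat (godel f) (godel g))
  | Comp f g => pair_nat 2 (pair_nat (godel f) (godel g))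
  | Prec f g => pair_nat 3 (pair_nat (godel f) (godel g))
  | Mu f => pair_nat 4 (godel f)
  end.

Definition jump (A : set nat) : set nat :=
  [set e | exists2 c, e = godel c & halts A c e].

Definition zero_jump : set nat := jump set0.

Definition computable (f : nat -> nat) : Prop :=
  exists c, forall n, eval_prog set0 c n (f n).

Definition ce_in (A S : set nat) : Prop :=
  exists c, S = [set n | halts A c n].

(* A sequence of rationals is computable when it can be written as a computable
   sequence of formal fractions (p - m) / (d + 1). *)
Definition computable_rat (q : nat -> rat) : Prop :=
  exists p m d : nat -> nat,
    [/\ computable p, computable m, computable d &
        forall k, q k = ((p k)%:R - (m k)%:R) / (d k).+1%:R].

(** * Left-c.e. randomness *)

Definition uniformly_left_ce (R : realType) (a : nat -> nat -> R) : Prop :=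
  exists2 q : nat -> nat -> nat -> rat,
    computable_rat (fun k => q (fst_nat k) (fst_nat (snd_nat k))
                               (snd_nat (snd_nat k))) &
    forall n i, nondecreasing_seq (q n i) /\
                (ratr (q n i s) : R) @[s --> \oo] --> a n i.

Definition left_ce_test (R : realType) (V : nat -> set R) : Prop :=
  exists a b : nat -> nat -> R,
    [/\ uniformly_left_ce a, uniformly_left_ce b,
        forall n i, 0 <= a n i /\ a n i <= b n i /\ b n i <= 1,
        forall n, V n = \bigcup_i `[a n i, b n i]%classic &
        forall n, (lebesgue_measure (V n) <= (2 ^- n)%:E)%E].

Definition left_ce_random (R : realType) (x : R) : Prop :=
  forall V : nat -> set R, left_ce_test V -> ~ (\bigcap_n V n) x.

(** * Martin-Löf randomness relative to an oracle *)

(* The real 0.X(0)X(1)X(2)... in binary; every real of [0, 1] is of this form. *)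
Definition bin_val (R : realType) (X : nat -> bool) : R :=
  limn ((fun n => \sum_(k < n) (X k)%:R / 2 ^+ k.+1) : nat -> R).

Definition cylinder (s : seq bool) : set (nat -> bool) :=
  [set X | mkseq X (size s) = s].

Definition open_of (W : set (seq bool)) : set (nat -> bool) :=
  \bigcup_(s in W) cylinder s.

(* The string s is coded by the number with binary expansion 1s. *)
Definition code_string (s : seq bool) : nat :=
  foldl (fun (m : nat) (b : bool) => (m.*2 + b)%N) 1%N s.

(* Lebesgue measure on 2^omega, via the identification with [0, 1]. *)
Definition mu_cantor (R : realType) (U : set (nat -> bool)) : \bar R :=
  lebesgue_measure (@bin_val R @` U).

Definition ml_test (R : realType) (A : set nat) (U : nat -> set (nat -> bool)) :
    Prop :=
  exists W : nat -> set (seq bool),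
    [/\ ce_in A [set k | exists n s, k = pair_nat n (code_string s) /\ W n s],
        forall n, U n = open_of (W n) &
        forall n, (mu_cantor R (U n) <= (2 ^- n)%:E)%E].

Definition ml_random (R : realType) (A : set nat) (X : nat -> bool) : Prop :=
  forall U, ml_test R A U -> ~ (\bigcap_n U n) X.

Definition two_random (R : realType) (X : nat -> bool) : Prop :=
  ml_random R zero_jump X.

(* Main.v *)
Require Import Defs.
From mathcomp Require Import all_boot all_order all_algebra.
From mathcomp Require Import all_classical all_reals all_analysis.
From HB Require Import structures.
From mathcomp Require Import zify ring lra.
From Stdlib Require Cantor.
Set Implicit Arguments.
Unset Strict Implicit.
Unset Printing Implicit Defensive.

(** Each direction turns a test of one kind into a test of the other kind whose
    measure is larger by a controlled amount.

    From left-c.e. randomness to 2-randomness.  A set of strings that is c.e. in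
    the halting problem is Sigma_2: s belongs to it iff there is a u such that
    D(s, u, t) holds for all t, with D computable
    ([ce_in_zero_jump_Sigma2]).  To each pair (s, u) attach an interval whose
    right end is the right end of the dyadic interval of s, and whose left end
    starts at the left end of that dyadic interval and jumps to the right end
    as soon as some t refutes D(s, u, t).  The left end only increases, so this
    is an interval with left-c.e. end points.  If u is a witness for s it is
    the whole dyadic interval, and otherwise it is a single point.  Hence the
    left-c.e. test so obtained contains the given Martin-Loef test and exceeds it
    by countably many points, that is, by a null set
    ([left_ce_random_two_random]).

    From 2-randomness to left-c.e. randomness.  The i-th interval [a, b] of the
    component n + 1 of a left-c.e. test is covered by dyadic intervals
    [v / 2^L, (v + 1) / 2^L] with L = n + i + 4.  Those with (v - 1) / 2^L < b and
    a <= (v + 1) / 2^L suffice and stay within [a - 2^-L, b + 2 * 2^-L].  The first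
    condition is Sigma_1 and the second is Pi_1, because a and b are limits of
    increasing computable sequences; so the halting problem decides the second
    and enumerates the pairs satisfying both.  The excess 3 * 2^-L, summed over
    i, is at most 2^-(n+1) ([two_random_left_ce_random]).

    Both arguments rest on some recursion theory.  Functions between types in
    effective bijection with the natural numbers are shown computable by closure
    properties ([recursive]), Sigma_1 predicates are decided by the jump through
    an s-m-n construction ([recursive_jump]), and the Sigma_2 form is a
    relativized Kleene normal form.  Instead of running a universal machine, it
    checks certificates: finite lists of facts (program, input, output) in which
    each fact follows from those after it by one evaluation rule, the answers of
    the oracle being recorded as facts to be verified separately
    ([certified_eval], [eval_certified]).  On the analytic side, the real with
    binary expansion X is the only common point of the dyadic intervals of the
    prefixes of X, so a cylinder is mapped onto its dyadic interval
    ([bin_val_cylinder]). *)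

(** * Types in bijection with the natural numbers *)

Local Arguments pair_nat : simpl never.
Local Arguments fst_nat : simpl never.
Local Arguments snd_nat : simpl never.

Lemma pair_natK1 m n : fst_nat (pair_nat m n) = m.
Proof. by rewrite /fst_nat /pair_nat Cantor.cancel_of_to. Qed.

Lemma pair_natK2 m n : snd_nat (pair_nat m n) = n.
Proof. by rewrite /snd_nat /pair_nat Cantor.cancel_of_to. Qed.

Definition pair_natK := (pair_natK1, pair_natK2).

Lemma fst_snd_natK n : pair_nat (fst_nat n) (snd_nat n) = n.
Proof.
by rewrite /fst_nat /snd_nat /pair_nat -surjective_pairing Cantor.cancel_to_of.
Qed.

Lemma pair_nat_inj m n m' n' : pair_nat m n = pair_nat m' n' -> m = m' /\ n = n'.
Proof. by move=> e; move: (congr1 fst_nat e) (congr1 snd_nat e); rewrite !pair_natK. Qed.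

Lemma snd_nat_le n : snd_nat n <= n.
Proof.
rewrite -{2}(fst_snd_natK n).
by have := Cantor.to_nat_non_decreasing (fst_nat n) (snd_nat n);
   rewrite -/(pair_nat _ _); lia.
Qed.

(** A bijection, and not just an injection: then quantifying over a coded type is
    the same as quantifying over [nat], and decoding is computed by the identity
    program. *)
HB.mixin Record hasNatCode T := {
  natcode : T -> nat;
  natdecode : nat -> T;
  natcodeK : cancel natcode natdecode;
  natdecodeK : cancel natdecode natcode }.
#[short(type="codeType")]
HB.structure Definition NatCode := {T of Equality T & hasNatCode T}.

Lemma natcode_inj (T : codeType) : injective (@natcode T).
Proof. exact: can_inj (@natcodeK T). Qed.

HB.instance Definition _ :=
  hasNatCode.Build nat (frefl id : cancel id id) (frefl id : cancel id id).

Definition code_pair (S T : codeType) (p : S * T) := pair_nat (natcode p.1) (natcode p.2).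
Definition decode_pair (S T : codeType) n : S * T :=
  (natdecode (fst_nat n), natdecode (snd_nat n)).

Lemma code_pairK (S T : codeType) : cancel (@code_pair S T) (@decode_pair S T).
Proof. by case=> a b; rewrite /decode_pair /code_pair !pair_natK !natcodeK. Qed.

Lemma decode_pairK (S T : codeType) : cancel (@decode_pair S T) (@code_pair S T).
Proof. by move=> n; rewrite /decode_pair /code_pair !natdecodeK fst_snd_natK. Qed.

HB.instance Definition _ (S T : codeType) :=
  hasNatCode.Build (S * T)%type (@code_pairK S T) (@decode_pairK S T).

Fixpoint code_seq (T : codeType) (s : seq T) : nat :=
  if s is x :: s' then (pair_nat (natcode x) (code_seq s')).+1 else 0.
(** [k] bounds the recursion depth; [n] itself is always enough, as the code of the
    tail is smaller. *)
Fixpoint decode_seq_upto (T : codeType) (k n : nat) : seq T :=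
  match k, n with
  | k'.+1, n'.+1 => natdecode (fst_nat n') :: decode_seq_upto T k' (snd_nat n')
  | _, _ => [::]
  end.
Definition decode_seq (T : codeType) n : seq T := decode_seq_upto T n n.

Lemma code_seq_cons_gt (T : codeType) (x : T) s : code_seq s < code_seq (x :: s).
Proof. by rewrite /= ltnS -{1}(pair_natK2 (natcode x) (code_seq s)) snd_nat_le. Qed.

Lemma code_seqK (T : codeType) : cancel (@code_seq T) (@decode_seq T).
Proof.
move=> s; rewrite /decode_seq; have := leqnn (code_seq s).
elim: s {2 3}(code_seq s) => [|x s IH] [|k] // lek.
rewrite [LHS]/= pair_natK1 pair_natK2 natcodeK IH //.
by rewrite -ltnS (leq_trans _ lek) // code_seq_cons_gt.
Qed.

Lemma decode_seqK (T : codeType) : cancel (@decode_seq T) (@code_seq T).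
Proof.
move=> n; rewrite /decode_seq; move: {2 3}n (leqnn n) => k.
elim: k n => [|k IH] [|n] //= len.
by rewrite natdecodeK IH ?fst_snd_natK // (leq_trans (snd_nat_le n)).
Qed.

HB.instance Definition _ (T : codeType) :=
  hasNatCode.Build (seq T) (@code_seqK T) (@decode_seqK T).

Lemma size_le_code (T : codeType) (s : seq T) : size s <= natcode s.
Proof.
by elim: s => [|x s IH] //; rewrite (leq_ltn_trans IH) // code_seq_cons_gt.
Qed.

(** * Functions computable relative to an oracle *)

Definition recursive (A : set nat) (S T : codeType) (f : S -> T) :=
  exists c, forall x, eval_prog A c (natcode x) (natcode (f x)).

Lemma recursive_comp A (S T U : codeType) (f : T -> U) (g : S -> T) :
  recursive A f -> recursive A g -> recursive A (fun x => f (g x)).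
Proof. by move=> [c cP] [d dP]; exists (Comp c d) => x; exists (natcode (g x)). Qed.

Lemma recursive_id A (S : codeType) : recursive A (fun x : S => x).
Proof.
exists (Pair Fst Snd) => x; exists (fst_nat (natcode x)), (snd_nat (natcode x)).
by rewrite fst_snd_natK.
Qed.

Fixpoint const_prog k := if k is k'.+1 then Comp Succ (const_prog k') else Zero.

Lemma eval_const_prog A k n : eval_prog A (const_prog k) n k.
Proof. by elim: k => [|k IH] //=; exists k. Qed.

Lemma recursive_const A (S T : codeType) (a : T) : recursive A (fun _ : S => a).
Proof. by exists (const_prog (natcode a)) => x; apply: eval_const_prog. Qed.

Lemma recursive_pair A (S T U : codeType) (f : S -> T) (g : S -> U) :
  recursive A f -> recursive A g -> recursive A (fun x => (f x, g x)).
Proof.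
move=> [c cP] [d dP]; exists (Pair c d) => x.
by exists (natcode (f x)), (natcode (g x)).
Qed.

Lemma recursive_fst A (S T U : codeType) (f : S -> T * U) :
  recursive A f -> recursive A (fun x => (f x).1).
Proof.
apply: (@recursive_comp _ _ _ _ fst); exists Fst => -[a b].
by rewrite /= [natcode (a, b)]/natcode /= /code_pair pair_natK.
Qed.

Lemma recursive_snd A (S T U : codeType) (f : S -> T * U) :
  recursive A f -> recursive A (fun x => (f x).2).
Proof.
apply: (@recursive_comp _ _ _ _ snd); exists Snd => -[a b].
by rewrite /= [natcode (a, b)]/natcode /= /code_pair pair_natK.
Qed.

Lemma recursive_succ A (S : codeType) (f : S -> nat) :
  recursive A f -> recursive A (fun x => (f x).+1).
Proof. by apply: (@recursive_comp _ _ _ _ succn); exists Succ. Qed.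

Lemma recursive_pair_nat A (S : codeType) (f g : S -> nat) :
  recursive A f -> recursive A g -> recursive A (fun x => pair_nat (f x) (g x)).
Proof. exact: recursive_pair. Qed.

Lemma recursive_fst_nat A (S : codeType) (f : S -> nat) :
  recursive A f -> recursive A (fun x => fst_nat (f x)).
Proof. by apply: (@recursive_comp _ _ _ _ fst_nat); exists Fst. Qed.

Lemma recursive_snd_nat A (S : codeType) (f : S -> nat) :
  recursive A f -> recursive A (fun x => snd_nat (f x)).
Proof. by apply: (@recursive_comp _ _ _ _ snd_nat); exists Snd. Qed.

(** Primitive recursion: [Prec] is run on the pair made of the parameter, which
    the step function reads back, and of the number of iterations. *)
Lemma recursive_iteri A (S T : codeType) (n : S -> nat) (h : S -> nat -> T -> T)
    (f : S -> T) :
  recursive A n -> recursive A (fun p : S * (nat * T) => h p.1 p.2.1 p.2.2) ->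
  recursive A f -> recursive A (fun x => iteri (n x) (h x) (f x)).
Proof.
move=> [cn cnP] [ch chP] [cf cfP].
exists (Comp (Prec cf ch) (Pair (Pair Fst Snd) cn)) => x.
exists (pair_nat (natcode x) (n x)).
  exists (natcode x), (n x); split=> //.
  by exists (fst_nat (natcode x)), (snd_nat (natcode x)); rewrite fst_snd_natK.
rewrite /= !pair_natK; elim: (n x) => [|k IH] //=.
exists (natcode (iteri k (h x) (f x))) => //.
exact: (chP (x, (k, iteri k (h x) (f x)))).
Qed.

(** A conditional is an iteration whose length is the truth value. *)
Lemma recursive_if A (S T : codeType) (b : S -> bool) (f g : S -> T) :
  recursive A (fun x => nat_of_bool (b x)) -> recursive A f -> recursive A g ->
  recursive A (fun x => if b x then f x else g x).
Proof.
move=> bP fP gP.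
have -> : (fun x => if b x then f x else g x) =
          (fun x => iteri (nat_of_bool (b x)) (fun _ _ => f x) (g x)).
  by apply/funext => x; case: (b x).
apply: recursive_iteri => //.
by apply: (@recursive_comp A _ _ _ f) => //; apply/recursive_fst/recursive_id.
Qed.

Lemma recursive_iter A (S T : codeType) (n : S -> nat) (h : S -> T -> T)
    (f : S -> T) :
  recursive A n -> recursive A (fun p : S * T => h p.1 p.2) ->
  recursive A f -> recursive A (fun x => iter (n x) (h x) (f x)).
Proof.
move=> nP hP fP.
have -> : (fun x => iter (n x) (h x) (f x)) =
          (fun x => iteri (n x) (fun _ => h x) (f x)).
  by apply/funext => x; elim: (n x) => [|k IH] //=; rewrite IH.
apply: recursive_iteri => //.
apply: (@recursive_comp A _ _ _ (fun p => h p.1 p.2) (fun p => (p.1, p.2.2))) => //.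
apply: recursive_pair; first exact/recursive_fst/recursive_id.
exact/recursive_snd/recursive_snd/recursive_id.
Qed.

Lemma recursive_code A (S T : codeType) (f : S -> T) :
  recursive A f -> recursive A (fun x => natcode (f x)).
Proof. by []. Qed.

Lemma recursive_pred A (S : codeType) (f : S -> nat) :
  recursive A f -> recursive A (fun x => (f x).-1).
Proof.
move=> fP; have -> : (fun x => (f x).-1) = (fun x => iteri (f x) (fun j _ => j) 0).
  by apply/funext => x; case: (f x).
apply: recursive_iteri => //; last exact: recursive_const.
exact/recursive_fst/recursive_snd/recursive_id.
Qed.

Lemma recursive_add A (S : codeType) (f g : S -> nat) :
  recursive A f -> recursive A g -> recursive A (fun x => f x + g x).
Proof.
move=> fP gP; have -> : (fun x => f x + g x) = (fun x => iter (f x) succn (g x)).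
  by apply/funext => x; rewrite iter_succn addnC.
apply: recursive_iter => //; exact/recursive_succ/recursive_snd/recursive_id.
Qed.

Lemma recursive_sub A (S : codeType) (f g : S -> nat) :
  recursive A f -> recursive A g -> recursive A (fun x => f x - g x).
Proof.
move=> fP gP; have -> : (fun x => f x - g x) = (fun x => iter (g x) predn (f x)).
  by apply/funext => x; rewrite iter_predn.
apply: recursive_iter => //; exact/recursive_pred/recursive_snd/recursive_id.
Qed.

Lemma recursive_mul A (S : codeType) (f g : S -> nat) :
  recursive A f -> recursive A g -> recursive A (fun x => f x * g x).
Proof.
move=> fP gP; have -> : (fun x => f x * g x) = (fun x => iter (f x) (addn (g x)) 0).
  by apply/funext => x; rewrite iter_addn_0 mulnC.
apply: recursive_iter => //; last exact: recursive_const.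
apply: recursive_add; last exact/recursive_snd/recursive_id.
by apply: (@recursive_comp A _ _ _ g) => //; apply/recursive_fst/recursive_id.
Qed.

Lemma recursive_exp A (S : codeType) (f g : S -> nat) :
  recursive A f -> recursive A g -> recursive A (fun x => f x ^ g x).
Proof.
move=> fP gP; have -> : (fun x => f x ^ g x) = (fun x => iter (g x) (muln (f x)) 1).
  by apply/funext => x; rewrite iter_muln_1.
apply: recursive_iter => //; last exact: recursive_const.
apply: recursive_mul; last exact/recursive_snd/recursive_id.
by apply: (@recursive_comp A _ _ _ f) => //; apply/recursive_fst/recursive_id.
Qed.

Lemma recursive_andb A (S : codeType) (f g : S -> bool) :
  recursive A (fun x => nat_of_bool (f x)) -> recursive A (fun x => nat_of_bool (g x)) ->
  recursive A (fun x => nat_of_bool (f x && g x)).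
Proof.
move=> fP gP; have -> : (fun x => nat_of_bool (f x && g x)) =
    (fun x => if f x then nat_of_bool (g x) else 0).
  by apply/funext => x; case: (f x).
by apply: recursive_if => //; exact: recursive_const.
Qed.

Lemma recursive_orb A (S : codeType) (f g : S -> bool) :
  recursive A (fun x => nat_of_bool (f x)) -> recursive A (fun x => nat_of_bool (g x)) ->
  recursive A (fun x => nat_of_bool (f x || g x)).
Proof.
move=> fP gP; have -> : (fun x => nat_of_bool (f x || g x)) =
    (fun x => if f x then 1 else nat_of_bool (g x)).
  by apply/funext => x; case: (f x).
by apply: recursive_if => //; exact: recursive_const.
Qed.

Lemma recursive_negb A (S : codeType) (f : S -> bool) :
  recursive A (fun x => nat_of_bool (f x)) ->
  recursive A (fun x => nat_of_bool (~~ f x)).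
Proof.
move=> fP; have -> : (fun x => nat_of_bool (~~ f x)) = (fun x => if f x then 0 else 1).
  by apply/funext => x; case: (f x).
by apply: recursive_if => //; exact: recursive_const.
Qed.

Lemma recursive_implb A (S : codeType) (f g : S -> bool) :
  recursive A (fun x => nat_of_bool (f x)) -> recursive A (fun x => nat_of_bool (g x)) ->
  recursive A (fun x => nat_of_bool (f x ==> g x)).
Proof.
move=> fP gP; under eq_fun do rewrite implybE.
by apply: recursive_orb => //; apply: recursive_negb.
Qed.

Lemma recursive_leq A (S : codeType) (f g : S -> nat) :
  recursive A f -> recursive A g -> recursive A (fun x => nat_of_bool (f x <= g x)).
Proof.
move=> fP gP; have -> : (fun x => nat_of_bool (f x <= g x)) =
    (fun x => iter (f x - g x) (fun _ => 0) 1).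
  by apply/funext => x; rewrite -subn_eq0; case: (f x - g x).
apply: recursive_iter; [exact: recursive_sub|exact: recursive_const..].
Qed.

Lemma recursive_eq A (S : codeType) (T : codeType) (f g : S -> T) :
  recursive A f -> recursive A g -> recursive A (fun x => nat_of_bool (f x == g x)).
Proof.
move=> fP gP.
have cP h : recursive A h -> recursive A (fun x : S => natcode (h x : T)) by [].
have -> : (fun x => nat_of_bool (f x == g x)) =
    (fun x => nat_of_bool ((natcode (f x) <= natcode (g x)) && (natcode (g x) <= natcode (f x)))).
  by apply/funext => x; rewrite -eqn_leq (inj_eq (@natcode_inj T)).
by apply: recursive_andb; apply: recursive_leq; apply: cP.
Qed.

Lemma recursive_cons A (S T : codeType) (f : S -> T) (g : S -> seq T) :
  recursive A f -> recursive A g -> recursive A (fun x => f x :: g x).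
Proof. by move=> fP gP; apply/(@recursive_succ A)/recursive_pair_nat. Qed.

(** On codes, the tail is the second component of the predecessor; this also
    sends the code 0 of the empty list to 0. *)
Lemma recursive_behead A (S T : codeType) (f : S -> seq T) :
  recursive A f -> recursive A (fun x => behead (f x)).
Proof.
move=> fP.
have [c cP] : recursive A (fun x => snd_nat (natcode (f x)).-1).
  exact/recursive_snd_nat/recursive_pred.
exists c => x; have := cP x; case: (f x) => [|y s] //=.
by rewrite pair_natK.
Qed.

Lemma recursive_head A (S T : codeType) (f : S -> seq T) :
  recursive A f -> recursive A (fun x => head (natdecode 0) (f x)).
Proof.
move=> fP.
have [c cP] : recursive A (fun x => fst_nat (natcode (f x)).-1).
  exact/recursive_fst_nat/recursive_pred.
exists c => x; have := cP x; case: (f x) => [|y s] /=; first by rewrite natdecodeK.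
by rewrite pair_natK.
Qed.

Lemma recursive_if_bool A (S : codeType) (b f g : S -> bool) :
  recursive A (fun x => nat_of_bool (b x)) -> recursive A (fun x => nat_of_bool (f x)) ->
  recursive A (fun x => nat_of_bool (g x)) ->
  recursive A (fun x => nat_of_bool (if b x then f x else g x)).
Proof.
move=> bP fP gP; have -> : (fun x => nat_of_bool (if b x then f x else g x)) =
    (fun x => if b x then nat_of_bool (f x) else nat_of_bool (g x)).
  by apply/funext => x; case: (b x).
exact: recursive_if.
Qed.

(** Hypotheses close goals up to their arguments; an uncurried hypothesis on [P]
    applies to goals in which [P] is applied to several functions of [x]. *)
Ltac recursive_hyp :=
  match goal with
  | H : recursive _ _ |- _ => simple apply H
  | H : recursive _ (fun p => nat_of_bool (?P p.1 p.2)) |-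
    recursive _ (fun x => nat_of_bool (?P (@?a x) (@?b x))) =>
      refine (recursive_comp (g := fun x => (a x, b x)) H _)
  | H : recursive _ (fun p => nat_of_bool (?P p.1 p.2.1 p.2.2)) |-
    recursive _ (fun x => nat_of_bool (?P (@?a x) (@?b x) (@?c x))) =>
      refine (recursive_comp (g := fun x => (a x, (b x, c x))) H _)
  | H : recursive _ (fun p => ?P p.1 p.2.1 p.2.2) |-
    recursive _ (fun x => ?P (@?a x) (@?b x) (@?c x)) =>
      refine (recursive_comp (g := fun x => (a x, (b x, c x))) H _)
  end.

(** Redefined once the closure properties for lists are available. *)
Ltac recursive_seq := fail.

(** Syntax-directed use of the closure properties.  Constants and hypotheses are
    tried with [simple apply], which does not unfold: otherwise failing attempts
    could evaluate codes of programs. *)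
Ltac recursive_step :=
  first [recursive_hyp | simple apply recursive_const | recursive_seq | recursive_head ]; cbv beta zeta
with recursive_head :=
  lazymatch goal with
  | |- recursive _ (fun x => x) => apply: recursive_id
  | |- recursive _ id => apply: recursive_id
  | |- recursive _ fst => apply: (@recursive_fst _ _ _ _ (fun x => x))
  | |- recursive _ snd => apply: (@recursive_snd _ _ _ _ (fun x => x))
  | |- recursive _ (fun x => natcode (@?a x)) => apply: recursive_code
  | |- recursive _ fst_nat => apply: (@recursive_fst_nat _ _ (fun x => x))
  | |- recursive _ snd_nat => apply: (@recursive_snd_nat _ _ (fun x => x))
  | |- recursive _ (fun x => (@?a x, @?b x)) => apply: recursive_pair
  | |- recursive _ (fun x => (@?a x).1) => apply: recursive_fst
  | |- recursive _ (fun x => (@?a x).2) => apply: recursive_snd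
  | |- recursive _ (fun x => (@?a x).+1) => apply: recursive_succ
  | |- recursive _ (fun x => (@?a x).-1) => apply: recursive_pred
  | |- recursive _ (fun x => pair_nat (@?a x) (@?b x)) => apply: recursive_pair_nat
  | |- recursive _ (fun x => fst_nat (@?a x)) => apply: recursive_fst_nat
  | |- recursive _ (fun x => snd_nat (@?a x)) => apply: recursive_snd_nat
  | |- recursive _ (fun x => addn (@?a x) (@?b x)) => apply: recursive_add
  | |- recursive _ (fun x => subn (@?a x) (@?b x)) => apply: recursive_sub
  | |- recursive _ (fun x => muln (@?a x) (@?b x)) => apply: recursive_mul
  | |- recursive _ (fun x => expn (@?a x) (@?b x)) => apply: recursive_exp
  | |- recursive _ (fun x => iteri (@?a x) (@?b x) (@?c x)) => apply: recursive_iteri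
  | |- recursive _ (fun x => iter (@?a x) (@?b x) (@?c x)) => apply: recursive_iter
  | |- recursive _ (fun x => cons (@?a x) (@?b x)) => apply: recursive_cons
  | |- recursive _ (fun x => behead (@?a x)) => apply: recursive_behead
  | |- recursive _ (fun x => head (natdecode 0) (@?a x)) => apply: recursive_head
  | |- recursive _ (fun x => nat_of_bool (@?a x && @?b x)) => apply: recursive_andb
  | |- recursive _ (fun x => nat_of_bool (@?a x || @?b x)) => apply: recursive_orb
  | |- recursive _ (fun x => nat_of_bool (~~ @?a x)) => apply: recursive_negb
  | |- recursive _ (fun x => nat_of_bool (@?a x ==> @?b x)) => apply: recursive_implb
  | |- recursive _ (fun x => nat_of_bool (leq (@?a x) (@?b x))) => apply: recursive_leq
  | |- recursive _ (fun x => nat_of_bool (@?a x == @?b x)) => apply: recursive_eq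
  | |- recursive _ (fun x => nat_of_bool (?f x)) => fail
  | |- recursive _ (fun x => nat_of_bool (?f (@?b x))) =>
      first [recursive_hyp | apply: (@recursive_comp _ _ _ _ (fun y => nat_of_bool (f y)) b)]
  | |- recursive _ (fun x => nat_of_bool (@?a x)) => apply: recursive_if_bool
  | |- recursive _ (fun x => ?f x) => fail
  | |- recursive _ (fun x => ?f (@?b x)) =>
      first [recursive_hyp | apply: (@recursive_comp _ _ _ _ f b)]
  | |- recursive _ _ => apply: recursive_if
  end.

Ltac recursive_tac := cbv zeta; repeat recursive_step.

(** The fold is a loop on the state (rest of the list, accumulator).  The loop
    stalls on the empty list, so it may be run for as many steps as the code of
    the list, which bounds its length. *)
Lemma recursive_foldl A (S T U : codeType) (h : S -> U -> T -> U) (a : S -> U)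
    (l : S -> seq T) :
  recursive A (fun p : S * (U * T) => h p.1 p.2.1 p.2.2) ->
  recursive A a -> recursive A l ->
  recursive A (fun x => foldl (h x) (a x) (l x)).
Proof.
move=> hP aP lP.
pose step x (st : seq T * U) :=
  if st.1 == [::] then st else (behead st.1, h x st.2 (head (natdecode 0) st.1)).
have stepE x : forall k s u, size s <= k -> iter k (step x) (s, u) = ([::], foldl (h x) u s).
  elim=> [|k IH] [|y s] u // sk; rewrite iterSr /step /=.
    exact: IH.
  exact: IH.
have -> : (fun x => foldl (h x) (a x) (l x)) =
    (fun x => (iter (natcode (l x)) (step x) (l x, a x)).2).
  by apply/funext => x; rewrite stepE ?size_le_code.
by rewrite /step; recursive_tac.
Qed.

Lemma recursive_foldr A (S T U : codeType) (h : S -> T -> U -> U) (a : S -> U)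
    (l : S -> seq T) :
  recursive A (fun p : S * (T * U) => h p.1 p.2.1 p.2.2) ->
  recursive A a -> recursive A l ->
  recursive A (fun x => foldr (h x) (a x) (l x)).
Proof.
move=> hP aP lP.
have -> : (fun x => foldr (h x) (a x) (l x)) =
    (fun x => foldl (fun z y => h x y z) (a x) (foldl (fun s y => y :: s) [::] (l x))).
  apply/funext => x.
  transitivity (foldl (fun z y => h x y z) (a x) (rev (l x))); first by rewrite foldl_rev.
  congr foldl.
  have catP s t : foldl (fun s y => y :: s) t s = rev s ++ t.
    by elim: s t => [|y s IH] t //=; rewrite IH rev_cons cat_rcons.
  by rewrite catP cats0.
by apply: recursive_foldl; recursive_tac; apply: recursive_foldl; recursive_tac.
Qed.

Lemma recursive_has A (S T : codeType) (P : S -> T -> bool) (l : S -> seq T) :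
  recursive A (fun p : S * T => nat_of_bool (P p.1 p.2)) -> recursive A l ->
  recursive A (fun x => nat_of_bool (has (P x) (l x))).
Proof.
move=> hP lP.
have -> : (fun x => nat_of_bool (has (P x) (l x))) =
    (fun x => foldr (fun y b => if P x y then 1 else b) 0 (l x)).
  by apply/funext => x; elim: (l x) => [|y s IH] //=; rewrite -IH; case: (P x y).
by apply: recursive_foldr; recursive_tac.
Qed.

Lemma recursive_all A (S T : codeType) (P : S -> T -> bool) (l : S -> seq T) :
  recursive A (fun p : S * T => nat_of_bool (P p.1 p.2)) -> recursive A l ->
  recursive A (fun x => nat_of_bool (all (P x) (l x))).
Proof.
move=> hP lP.
have -> : (fun x => nat_of_bool (all (P x) (l x))) =
    (fun x => nat_of_bool (~~ has (fun y => ~~ P x y) (l x))).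
  apply/funext => x; rewrite -all_predC; congr nat_of_bool.
  by apply: eq_all => y /=; rewrite negbK.
by recursive_tac; apply: recursive_has => //; recursive_tac.
Qed.

Lemma recursive_mem A (S T : codeType) (f : S -> T) (l : S -> seq T) :
  recursive A f -> recursive A l ->
  recursive A (fun x => nat_of_bool (f x \in l x)).
Proof.
move=> fP lP; have -> : (fun x => nat_of_bool (f x \in l x)) =
    (fun x => nat_of_bool (has (fun y => f x == y) (l x))).
  apply/funext => x; congr nat_of_bool.
  by elim: (l x) => [|y s IH] //=; rewrite in_cons IH.
by apply: recursive_has => //; recursive_tac.
Qed.

Lemma recursive_iota A (S : codeType) (n : S -> nat) :
  recursive A n -> recursive A (fun x => iota 0 (n x)).
Proof.
move=> nP; have -> : (fun x => iota 0 (n x)) =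
  (fun x => iteri (n x) (fun j s => foldr cons [:: j] s) [::]).
  apply/funext => x; elim: (n x) => [|k IH] //; rewrite [RHS]/= -IH.
  have -> s : foldr cons [:: k] s = s ++ [:: k] by elim: s => //= y s ->.
  by rewrite -addn1 iotaD.
apply: recursive_iteri => //; last by recursive_tac.
by apply: recursive_foldr; recursive_tac.
Qed.

(** [J x w] says that [x] follows in one step from elements of [w].  A certified
    list is thus a derivation, read from its end. *)
Fixpoint certified (T : Type) (J : T -> seq T -> bool) (w : seq T) : bool :=
  if w is x :: w' then J x w' && certified J w' else true.

Lemma certified_cat (T : eqType) (J : T -> seq T -> bool) w1 w2 :
  (forall x w w', {subset w <= w'} -> J x w -> J x w') ->
  certified J w1 -> certified J w2 -> certified J (w1 ++ w2).
Proof.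
move=> mono + w2P; elim: w1 => [|x w1 IH] //= /andP[Jx /IH ->]; rewrite andbT.
by apply: mono Jx => y yw; rewrite mem_cat yw.
Qed.

Lemma recursive_certified A (S T : codeType) (J : T -> seq T -> bool) (w : S -> seq T) :
  recursive A (fun p : T * seq T => nat_of_bool (J p.1 p.2)) -> recursive A w ->
  recursive A (fun x => nat_of_bool (certified J (w x))).
Proof.
move=> JP wP; have -> : (fun x => nat_of_bool (certified J (w x))) =
  (fun x => (foldr (fun y (st : nat * seq T) => (if J y st.2 then st.1 else 0, y :: st.2))
               (1, [::]) (w x)).1).
  apply/funext => x.
  suff -> s : foldr (fun y (st : nat * seq T) =>
      (if J y st.2 then st.1 else 0, y :: st.2)) (1, [::]) s =
      (nat_of_bool (certified J s), s) by [].
  by elim: s => [|y s IH] //=; rewrite IH /=; case: (J y s).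
by apply: recursive_fst; apply: recursive_foldr; recursive_tac.
Qed.

Ltac recursive_seq ::=
  lazymatch goal with
  | |- recursive _ (fun x => nat_of_bool (has (@?a x) (@?b x))) =>
      apply: recursive_has
  | |- recursive _ (fun x => nat_of_bool (all (@?a x) (@?b x))) =>
      apply: recursive_all
  | |- recursive _ (fun x => nat_of_bool (@?a x \in @?b x)) => apply: recursive_mem
  | |- recursive _ (fun x => iota 0 (@?b x)) => apply: recursive_iota
  | |- recursive _ (fun x => nat_of_bool (certified (@?a x) (@?b x))) =>
      apply: recursive_certified
  end.

(** * The jump decides existential predicates *)

Lemma eval_prog_fun A c n m m' :
  eval_prog A c n m -> eval_prog A c n m' -> m = m'.
Proof.
elim: c n m m' => [||||| f IHf g IHg | f IHf g IHg | f IHf g IHg | f IHf] n m m' /=.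
1-5: by move=> -> ->.
- move=> [u [v [fu gv ->]]] [u' [v' [fu' gv' ->]]].
  by rewrite (IHf _ _ _ fu fu') (IHg _ _ _ gv gv').
- move=> [u gu fu] [u' gu' fu'].
  by move: fu'; rewrite -(IHg _ _ _ gu gu'); apply: IHf.
- elim: (snd_nat n) m m' => [|k IH] m m'; first exact: IHf.
  move=> [s ks gs] [s' ks' gs'].
  by move: gs'; rewrite -(IH _ _ ks ks'); apply: IHg.
- move=> [fm ltm] [fm' ltm']; case: (ltngtP m m') => // lmm.
  + by have [v /(IHf _ _ _ fm)] := ltm' _ lmm.
  + by have [v /(IHf _ _ _ fm')] := ltm _ lmm.
Qed.

(** Unbounded search for a witness. *)
Lemma halts_Mu A (S T : codeType) (P : S -> T -> bool) :
  recursive A (fun p : S * T => nat_of_bool (P p.1 p.2)) ->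
  exists c, forall x, halts A c (natcode x) <-> exists y, P x y.
Proof.
move=> PP.
have [c cP] : recursive A (fun p : S * T => nat_of_bool (~~ P p.1 p.2)).
  by recursive_tac.
have {}cP x n : eval_prog A c (pair_nat (natcode x) n) (~~ P x (natdecode n)).
  by have := cP (x, natdecode n); rewrite {1}/natcode /= /code_pair natdecodeK.
exists (Mu c) => x; split.
  move=> [m [/eval_prog_fun/(_ (cP _ _)) + _]].
  by case Pxm: (P x (natdecode m)) => // _; exists (natdecode m).
move=> [y Pxy]; have ex : exists n, P x (natdecode n) by exists (natcode y); rewrite natcodeK.
exists (ex_minn ex); case: ex_minnP => m Pm minm; split.
  by have := cP x m; rewrite Pm.
move=> i lim; exists 0; have := cP x i.
suff -> : P x (natdecode i) = false by [].
by apply/negP => /minm; rewrite leqNgt lim.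
Qed.

Lemma ce_in_exists A (T : codeType) (P : nat -> T -> bool) :
  recursive A (fun p : nat * T => nat_of_bool (P p.1 p.2)) ->
  ce_in A [set k | exists y, P k y].
Proof.
move=> /halts_Mu[c cP]; exists c; apply/seteqP; split => k /=.
  by move=> /cP.
by move=> /cP.
Qed.

Lemma godel_inj : injective godel.
Proof.
by elim=> [||||| f IHf g IHg | f IHf g IHg | f IHf g IHg | f IHf];
   case=> [||||| f' g' | f' g' | f' g' | f'] //= /pair_nat_inj [] // _;
   try (move=> /pair_nat_inj [/IHf -> /IHg -> //]); try (by move=> /IHf ->).
Qed.

Lemma recursive_godel_const A : recursive A (fun k : nat => godel (const_prog k)).
Proof.
have -> : (fun k : nat => godel (const_prog k)) =
  (fun k => iter k (fun h => pair_nat 2 (pair_nat (godel Succ) h)) (godel Zero)).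
  by apply/funext; elim=> [|k IH] //=; rewrite IH.
by recursive_tac.
Qed.

(** By s-m-n: from [x] one computes the code of the program that ignores its input
    and searches for a witness for [x], and asks the oracle whether it halts on
    its own code. *)
Lemma recursive_jump (A : set nat) (S T : codeType) (P : S -> T -> bool) :
  recursive A (fun p : S * T => nat_of_bool (P p.1 p.2)) ->
  recursive (jump A) (fun x => nat_of_bool `[< exists y, P x y >]).
Proof.
move=> /halts_Mu[c cP].
have -> : (fun x => nat_of_bool `[< exists y, P x y >]) =
  (fun x => nat_of_bool (godel (Comp c (const_prog (natcode x))) \in jump A)).
  apply/funext => x; congr nat_of_bool; apply/asboolP/idP.
    move=> /cP[m cm]; rewrite inE; exists (Comp c (const_prog (natcode x))) => //.
    by exists m, (natcode x) => //; apply: eval_const_prog.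
  rewrite inE => -[d /godel_inj <-] [m [u /eval_prog_fun/(_ (eval_const_prog _ _ _)) -> cm]].
  by apply/cP; exists m.
apply: (@recursive_comp _ _ _ _ (fun e => nat_of_bool (e \in jump A))); first by exists Oracle.
have gP := recursive_godel_const (jump A).
rewrite /=; recursive_tac.
apply: (@recursive_comp _ S nat nat (fun k => godel (const_prog k)) (@natcode S)) => //.
exact: recursive_id.
Qed.

(** The empty oracle always answers 0, so calls to it can be replaced. *)
Fixpoint no_oracle (c : prog) : prog :=
  match c with
  | Oracle => Zero
  | Pair f g => Pair (no_oracle f) (no_oracle g)
  | Comp f g => Comp (no_oracle f) (no_oracle g)
  | Prec f g => Prec (no_oracle f) (no_oracle g)
  | Mu f => Mu (no_oracle f)
  | _ => c
  end.

Lemma eval_no_oracle A c n m : eval_prog set0 c n m <-> eval_prog A (no_oracle c) n m.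
Proof.
elim: c n m => [||||| f IHf g IHg | f IHf g IHg | f IHf g IHg | f IHf] n m //=.
- by rewrite in_set0.
- by split=> -[u [v [/IHf fu /IHg gv ->]]]; exists u, v.
- by split=> -[u /IHg gu /IHf fu]; exists u.
- elim: (snd_nat n) m => [|k IH] m //.
  by split=> -[s /IH ks /IHg gs]; exists s.
- split=> -[/IHf fm ltm]; split=> // i /ltm[v /IHf]; by exists v.
Qed.

Lemma recursive_oracle A (S T : codeType) (f : S -> T) :
  recursive set0 f -> recursive A f.
Proof. by move=> [c cP]; exists (no_oracle c) => x; apply/eval_no_oracle. Qed.

(** * Certificates of evaluation and the Sigma_2 normal form *)

(** One step of the derivation that a number is the code of a program. *)
Definition code_step (e : nat) (w : seq nat) : bool :=
  let t := fst_nat e in let r := snd_nat e in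
  if t == 0 then r <= 4
  else if t <= 3 then (fst_nat r \in w) && (snd_nat r \in w)
  else (t == 4) && (r \in w).

Lemma code_step_mono e w w' : {subset w <= w'} -> code_step e w -> code_step e w'.
Proof.
move=> sub; rewrite /code_step; case: ifP => // _; case: ifP => _.
  by move=> /andP[/sub -> /sub ->].
by move=> /andP[-> /sub ->].
Qed.

Lemma certified_code w e : certified code_step w -> e \in w -> exists c, e = godel c.
Proof.
elim: w e => [|x w IH] e //= /andP[xw wP]; rewrite in_cons => /orP[/eqP->|]; last exact: IH.
move: xw (fst_snd_natK x); rewrite /code_step.
case: (fst_nat x) => [|[|[|[|[|t]]]]] /=.
- case: (snd_nat x) => [|[|[|[|[|r]]]]] //= _ <-.
  + by exists Zero.
  + by exists Succ.
  + by exists Fst.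
  + by exists Snd.
  + by exists Oracle.
- move=> /andP[/(IH _ wP)[f fE] /(IH _ wP)[g gE]] <-; exists (Pair f g).
  by rewrite /= -fE -gE fst_snd_natK.
- move=> /andP[/(IH _ wP)[f fE] /(IH _ wP)[g gE]] <-; exists (Comp f g).
  by rewrite /= -fE -gE fst_snd_natK.
- move=> /andP[/(IH _ wP)[f fE] /(IH _ wP)[g gE]] <-; exists (Prec f g).
  by rewrite /= -fE -gE fst_snd_natK.
- by move=> /(IH _ wP)[f fE] <-; exists (Mu f); rewrite /= -fE.
- by [].
Qed.

Lemma code_certified c : exists2 w, certified code_step w & godel c \in w.
Proof.
have leaf r : r <= 4 -> exists2 w, certified code_step w & pair_nat 0 r \in w.
  by move=> r4; exists [:: pair_nat 0 r]; rewrite ?mem_seq1 //= /code_step !pair_natK r4.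
have node t f g : 0 < t <= 3 -> (exists2 w, certified code_step w & f \in w) ->
    (exists2 w, certified code_step w & g \in w) ->
    exists2 w, certified code_step w & pair_nat t (pair_nat f g) \in w.
  move=> t3 [w1 w1P fw] [w2 w2P gw].
  exists (pair_nat t (pair_nat f g) :: w1 ++ w2); last by rewrite in_cons eqxx.
  rewrite /= certified_cat //; last exact: code_step_mono.
  rewrite /code_step !pair_natK !mem_cat fw gw orbT /=.
  by case: t t3 => [|[|[|[|]]]].
elim: c => [||||| f IHf g IHg | f IHf g IHg | f IHf g IHg | f [w wP fw]];
  try exact: leaf; try exact: node.
exists (godel (Mu f) :: w); last by rewrite in_cons eqxx.
by rewrite /= wP /code_step !pair_natK fw.
Qed.


(** A fact is a triple (code of a program, input, output).  This is one rule of the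
    evaluation relation, with the premises looked up in [w]; a call to the oracle
    may be given any boolean answer. *)
Definition eval_step (x : nat * (nat * nat)) (w : seq (nat * (nat * nat))) : bool :=
  let t := fst_nat x.1 in let r := snd_nat x.1 in
  let f := fst_nat r in let g := snd_nat r in
  let n := x.2.1 in let m := x.2.2 in
  if t == 0 then
    if r == 0 then m == 0
    else if r == 1 then m == n.+1
    else if r == 2 then m == fst_nat n
    else if r == 3 then m == snd_nat n
    else (r == 4) && (m <= 1)
  else if t == 1 then ((f, (n, fst_nat m)) \in w) && ((g, (n, snd_nat m)) \in w)
  else if t == 2 then
    has (fun y => (y.1 == g) && (y.2.1 == n) && ((f, (y.2.2, m)) \in w)) w
  else if t == 3 then
    if snd_nat n == 0 then (f, (fst_nat n, m)) \in w
    else has (fun y => (y.1 == x.1) && (y.2.1 == pair_nat (fst_nat n) (snd_nat n).-1) &&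
           ((g, (pair_nat (fst_nat n) (pair_nat (snd_nat n).-1 y.2.2), m)) \in w)) w
  else (t == 4) && ((r, (pair_nat n m, 0)) \in w) &&
    all (fun i => has (fun y => (y.1 == r) && (y.2.1 == pair_nat n i) && (y.2.2 != 0)) w)
      (iota 0 m).

Lemma recursive_code_step A :
  recursive A (fun p : nat * seq nat => nat_of_bool (code_step p.1 p.2)).
Proof.
rewrite /code_step; by recursive_tac.
Qed.

Lemma recursive_eval_step A :
  recursive A (fun p : (nat * (nat * nat)) * seq (nat * (nat * nat)) =>
    nat_of_bool (eval_step p.1 p.2)).
Proof. by rewrite /eval_step; recursive_tac. Qed.

Lemma eval_step_mono x w w' : {subset w <= w'} -> eval_step x w -> eval_step x w'.
Proof.
move=> sub; rewrite /eval_step.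
have sub_has (p q : nat * (nat * nat) -> bool) : (forall y, p y -> q y) -> has p w -> has q w'.
  by move=> pq /hasP[y /sub yw' /pq qy]; apply/hasP; exists y.
case: ifP => // _; case: ifP => _; first by move=> /andP[/sub -> /sub ->].
case: ifP => _; first by apply: sub_has => y /andP[-> /sub].
case: ifP => _.
  case: ifP => _; first exact: sub.
  by apply: sub_has => y /andP[-> /sub].
move=> /andP[/andP[-> /sub ->]] /allP allw; apply/allP => i /allw.
exact: sub_has.
Qed.

(** What distinguishes the oracles: the certificates themselves do not mention any. *)
Definition oracle_consistent (A : set nat) (w : seq (nat * (nat * nat))) :=
  forall n b, (godel Oracle, (n, b)) \in w -> b = (n \in A).

(** Soundness.  The statement is about codes of programs only: a certificate may
    also contain facts about numbers that code no program, which are harmless. *)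
Lemma certified_eval A w c n m :
  certified eval_step w -> oracle_consistent A w ->
  (godel c, (n, m)) \in w -> eval_prog A c n m.
Proof.
elim: w c n m => [|x w IHw] c n m //= /andP[xw wP] Ax.
have {}IHw c' n' m' : (godel c', (n', m')) \in w -> eval_prog A c' n' m'.
  by apply: IHw => // n'' b bw; apply: Ax; rewrite in_cons bw orbT.
rewrite in_cons => /orP[/eqP xE|]; last exact: IHw.
have {Ax} Ax : c = Oracle -> m = (n \in A).
  by move=> cE; apply: Ax; rewrite -xE cE mem_head.
move: xw; rewrite -{}xE.
case: c Ax => [||||| f g | f g | f g | f] Ax;
  rewrite /eval_step /= ?pair_natK /=; try by move/eqP.
- by move=> _; apply: Ax.
- move=> /andP[/IHw fn /IHw gn]; exists (fst_nat m), (snd_nat m).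
  by rewrite fst_snd_natK.
- move=> /hasP[[g' [n' u]] gw /= /andP[/andP[/eqP g'E /eqP n'E] /IHw fu]].
  by exists u => //; apply: IHw; rewrite -g'E -n'E.
- case kE : (snd_nat n) => [|k] /=; first exact: IHw.
  move=> /hasP[[e [n' s]] ew /= /andP[/andP[/eqP eE /eqP n'E] /IHw gs]].
  exists s => //; have := IHw (Prec f g) n' s.
  by rewrite /= n'E !pair_natK; apply; rewrite /= -eE -n'E.
- move=> /andP[/IHw fm /allP ltm]; split=> // i im.
  have /ltm/hasP[[f' [n' v]] fw /= /andP[/andP[/eqP f'E /eqP n'E] v0]] : i \in iota 0 m.
    by rewrite mem_iota add0n.
  by exists v.-1; rewrite prednK ?lt0n //; apply: IHw; rewrite -f'E -n'E.
Qed.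

Lemma certificate_cons A w c n m :
  certified eval_step w /\ oracle_consistent A w ->
  eval_step (godel c, (n, m)) w -> (c = Oracle -> m = (n \in A)) ->
  exists2 w', certified eval_step w' /\ oracle_consistent A w' &
    (godel c, (n, m)) \in w'.
Proof.
move=> [wP Aw] xw cO; exists ((godel c, (n, m)) :: w); last exact: mem_head.
split; first by rewrite /= xw.
move=> n' b; rewrite in_cons => /orP[/eqP[/(@godel_inj Oracle) cE -> ->]|]; last exact: Aw.
exact: cO.
Qed.

Lemma certificate_cat A w1 w2 :
  certified eval_step w1 /\ oracle_consistent A w1 ->
  certified eval_step w2 /\ oracle_consistent A w2 ->
  certified eval_step (w1 ++ w2) /\ oracle_consistent A (w1 ++ w2).
Proof.
move=> [w1P A1] [w2P A2]; split; first exact: certified_cat eval_step_mono _ _.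
by move=> n b; rewrite mem_cat => /orP[/A1|/A2].
Qed.

(** Completeness: certificates of the premises are concatenated, which is possible
    because the rules are monotone in the list of available facts. *)
Lemma eval_certified A c n m : eval_prog A c n m ->
  exists2 w, certified eval_step w /\ oracle_consistent A w & (godel c, (n, m)) \in w.
Proof.
have nilP : certified eval_step [::] /\ oracle_consistent A [::] by [].
elim: c n m => [||||| f IHf g IHg | f IHf g IHg | f IHf g IHg | f IHf] n m.
1-4: by move=> mE; apply: (certificate_cons nilP) => //;
  rewrite /eval_step /= ?pair_natK /=; apply/eqP.
- move=> mE; apply: (certificate_cons nilP) => //.
  rewrite (mE : m = (n \in A)) /eval_step /= ?pair_natK /=.
  by case: (n \in A).
- move=> [u [v [/IHf[w1 w1P fw] /IHg[w2 w2P gw] ->]]].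
  apply: (certificate_cons (certificate_cat w1P w2P)) => //.
  by rewrite /eval_step /= ?pair_natK /= !mem_cat fw gw orbT.
- move=> [u /IHg[w2 w2P gw] /IHf[w1 w1P fw]].
  apply: (certificate_cons (certificate_cat w1P w2P)) => //.
  rewrite /eval_step /= ?pair_natK /=; apply/hasP; exists (godel g, (n, u)).
    by rewrite mem_cat gw orbT.
  by rewrite !eqxx mem_cat fw.
- rewrite -{2}(fst_snd_natK n) [eval_prog _ _ _ _]/=; move: (fst_nat n) => a.
  elim: (snd_nat n) m => [|k IH] m.
    move=> /IHf[w wP fw]; apply: (certificate_cons wP) => //.
    by rewrite /eval_step /= ?pair_natK.
  move=> [s /IH[w1 w1P ew] /IHg[w2 w2P gw]].
  apply: (certificate_cons (certificate_cat w1P w2P)) => //.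
  rewrite /eval_step /= ?pair_natK /=; apply/hasP.
  exists (godel (Prec f g), (pair_nat a k, s)); first by rewrite mem_cat ew.
  by rewrite !eqxx mem_cat gw orbT.
- move=> [/IHf[w1 w1P fw] ltm].
  have [w2 w2P allw] : exists2 w, certified eval_step w /\ oracle_consistent A w &
      forall i, i < m -> exists v, (godel f, (pair_nat n i, v.+1)) \in w.
    elim: m ltm {fw} => [|m IH] ltm; first by exists [::].
    have [|w2 w2P allw] := IH; first by move=> i im; apply: ltm; apply: ltnW.
    have [v /IHf[w3 w3P vw]] := ltm m (ltnSn m).
    exists (w3 ++ w2); first exact: certificate_cat.
    move=> i; rewrite ltnS leq_eqVlt => /orP[/eqP ->|/allw[u uw]].
      by exists v; rewrite mem_cat vw.
    by exists u; rewrite mem_cat uw orbT.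
  apply: (certificate_cons (certificate_cat w1P w2P)) => //.
  rewrite /eval_step /= ?pair_natK /= mem_cat fw /=.
  apply/allP => i; rewrite mem_iota add0n => /allw[v vw].
  by apply/hasP; exists (godel f, (pair_nat n i, v.+1)); rewrite ?mem_cat ?vw ?orbT // !eqxx.
Qed.

(** Evidence that [n] is in the jump of the empty set.  The jump contains only
    codes of programs, whereas [certified_eval] is silent about other numbers;
    hence the separate certificate that [n] is a code. *)
Definition jump_certificate (n : nat) (t : seq nat * seq (nat * (nat * nat))) : bool :=
  [&& certified code_step t.1, n \in t.1, certified eval_step t.2,
      all (fun y => (y.1 == godel Oracle) ==> (y.2.2 == 0)) t.2 &
      has (fun y => (y.1 == n) && (y.2.1 == n)) t.2].

Lemma zero_jumpP n : n \in zero_jump <-> exists t, jump_certificate n t.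
Proof.
rewrite inE; split.
  move=> [c -> [m /eval_certified[w [wP w0] cw]]].
  have [v vP cv] := code_certified c; exists (v, w).
  rewrite /jump_certificate /= vP cv wP /=; apply/andP; split.
    apply/allP => -[e [k b]] /= yw; apply/implyP => /eqP eE.
    by move: yw; rewrite eE => /w0 ->; rewrite in_set0.
  by apply/hasP; exists (godel c, (godel c, m)); rewrite //= !eqxx.
move=> [[v w] /and5P[/= vP nv wP /allP w0 /hasP[[e [k m]] ew /= /andP[/eqP eE /eqP kE]]]].
have [c cE] := certified_code vP nv; exists c => //; exists m.
apply: (certified_eval wP); last by rewrite -cE -{1}eE -{1}kE.
by move=> k' b /w0/=; rewrite ?eqxx in_set0 => /eqP.
Qed.

Lemma recursive_jump_certificate A :
  recursive A (fun p : nat * (seq nat * seq (nat * (nat * nat))) =>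
    nat_of_bool (jump_certificate p.1 p.2)).
Proof.
have H1 := recursive_code_step A; have H2 := recursive_eval_step A.
rewrite /jump_certificate; recursive_tac.
Qed.

(** The witness [u] consists of a certificate, valid for some oracle, and of a list
    of certificates for the positive answers of the oracle in it; the universal
    variable [t] ranges over potential refutations of the negative answers. *)
Lemma ce_in_zero_jump_Sigma2 (S : set nat) : ce_in zero_jump S ->
  exists2 D : nat -> nat -> nat -> bool,
    recursive set0 (fun p : nat * (nat * nat) => nat_of_bool (D p.1 p.2.1 p.2.2)) &
    forall k, S k <-> exists u, forall t, D k u t.
Proof.
move=> [c ->].
pose D (k : nat) (u : seq (nat * (nat * nat)) * seq (seq nat * seq (nat * (nat * nat)))) t :=
  [&& certified eval_step u.1, has (fun y => (y.1 == godel c) && (y.2.1 == k)) u.1 &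
      all (fun y => (y.1 == godel Oracle) ==>
        if y.2.2 == 1 then has (jump_certificate y.2.1) u.2
        else (y.2.2 == 0) && ~~ jump_certificate y.2.1 t) u.1].
exists (fun k u t => D k (natdecode u) (natdecode t)).
  have DP : recursive set0 (fun p : nat * ((seq (nat * (nat * nat)) *
      seq (seq nat * seq (nat * (nat * nat)))) * (seq nat * seq (nat * (nat * nat)))) =>
      nat_of_bool (D p.1 p.2.1 p.2.2)).
    have H1 := recursive_eval_step set0; have H2 := recursive_jump_certificate set0.
    by rewrite /D; recursive_tac.
  have [d dP] := DP; exists d => -[k [u t]].
  by have := dP (k, (natdecode u, natdecode t));
    rewrite {1}/natcode /= /code_pair /= /natcode /= /code_pair !natdecodeK.
move=> k; split.
  move=> [m /eval_certified[w [wP Aw] cw]].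
  (* one list serves all the finitely many positive queries of w *)
  have [ts tsP] : exists ts, forall n, (godel Oracle, (n, 1)) \in w ->
      has (jump_certificate n) ts.
    have A1 n : (godel Oracle, (n, 1)) \in w -> exists t, jump_certificate n t.
      by move=> /Aw /eqP; case: (boolP (n \in zero_jump)) => // /zero_jumpP.
    elim: (w) A1 => [|[e [n b]] w' IH] w'P.
      by exists [::].
    have [|ts tsP] := IH; first by move=> n' n'w; apply: w'P; rewrite in_cons n'w orbT.
    have [nE|nE] := pselect ((godel Oracle, (n, 1)) = (e, (n, b))).
      have [|t tP] := w'P n; first by rewrite nE mem_head.
      exists (t :: ts) => n'; rewrite in_cons => /orP[/eqP[_ -> _]|/tsP /= ->].
        by rewrite /= tP.
      by rewrite orbT.
    exists ts => n'; rewrite in_cons => /orP[/eqP n'E|/tsP //].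
    by case: nE; case: n'E => <- _ <-.
  exists (natcode (w, ts)) => t; rewrite natcodeK /D /= wP /=; apply/andP; split.
    by apply/hasP; exists (godel c, (k, m)); rewrite //= !eqxx.
  apply/allP => -[e [n b]] /= yw; apply/implyP => /eqP eE; move: yw; rewrite {}eE => yw.
  case: eqP => [b1|b1]; first by apply: tsP; rewrite -b1.
  have := Aw _ _ yw; case: (boolP (n \in zero_jump)) => [_ /b1|nA -> /=] //.
  by apply/negP => tP; case/negP: nA; apply/zero_jumpP; exists (natdecode t).
move=> [u uP]; case: (natdecode u) uP => w ts uP.
have /and3P[/= wP /hasP[[e [n m]] ew /= /andP[/eqP eE /eqP nE]] _] := uP 0.
exists m; apply: (certified_eval wP); last by rewrite -eE -nE.
move=> {m ew eE nE e}n b yw.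
have ay t : if b == 1 then has (jump_certificate n) ts
        else (b == 0) && ~~ jump_certificate n t.
  by have /and3P[_ _ /allP/(_ _ yw)] := uP (natcode t); rewrite natcodeK /= ?eqxx.
move: ay; case: eqP => [->|_] ay.
  have /hasP[t _ tP] := ay (natdecode 0).
  by have -> : n \in zero_jump by apply/zero_jumpP; exists t.
have /andP[/eqP -> _] := ay (natdecode 0).
have [/zero_jumpP[t tP]|//] := boolP (n \in zero_jump).
by have := ay t; rewrite tP andbF.
Qed.

(** * Binary expansions and dyadic intervals *)

Import Order.TTheory GRing.Theory Num.Theory numFieldNormedType.Exports.
Local Open Scope classical_set_scope.
Local Open Scope ring_scope.

(** [code_string] without the leading digit 1. *)
Definition string_value (s : seq bool) : nat :=
  foldl (fun (m : nat) (b : bool) => (m.*2 + b)%N) 0%N s.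

Lemma string_value_rcons s b :
  string_value (rcons s b) = ((string_value s).*2 + b)%N.
Proof. by rewrite /string_value foldl_rcons. Qed.

Lemma code_string_rcons s b : code_string (rcons s b) = ((code_string s).*2 + b)%N.
Proof. by rewrite /code_string foldl_rcons. Qed.

Lemma string_value_lt s : (string_value s < 2 ^ size s)%N.
Proof.
elim/last_ind: s => [|s b IH] //; rewrite string_value_rcons size_rcons expnS.
by case: b; lia.
Qed.

Lemma code_stringE s : code_string s = (2 ^ size s + string_value s)%N.
Proof.
elim/last_ind: s => [|s b IH] //.
by rewrite code_string_rcons string_value_rcons IH size_rcons expnS; lia.
Qed.

Lemma code_string_gt0 s : (0 < code_string s)%N.
Proof. by rewrite code_stringE addn_gt0 expn_gt0. Qed.

Lemma code_string_inj : injective code_string.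
Proof.
elim/last_ind => [|s b IH] t; case/lastP: t => [|t c] //.
- rewrite code_string_rcons; have := code_string_gt0 t.
  by case: c => /=; rewrite /code_string /=; lia.
- rewrite code_string_rcons; have := code_string_gt0 s.
  by case: b => /=; rewrite /code_string /=; lia.
rewrite !code_string_rcons => e; congr rcons; first by apply: IH; case: b c e => -[] /=; lia.
by case: b c e => -[] //=; lia.
Qed.

Lemma code_string_surj m : (0 < m)%N -> exists s, code_string s = m.
Proof.
elim/ltn_ind: m => m IH m0; have [->|m1] := eqVneq m 1%N; first by exists [::].
have [||s sE] := IH m./2; [lia..|].
by exists (rcons s (odd m)); rewrite code_string_rcons sE addnC odd_double_half.
Qed.

Lemma code_string_size s L v : (v < 2 ^ L)%N -> code_string s = (2 ^ L + v)%N ->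
  size s = L /\ string_value s = v.
Proof.
move=> vL; rewrite code_stringE => e; have := string_value_lt s => sl.
suff sE : size s = L by split=> //; move: e; rewrite sE; lia.
apply/eqP; rewrite eqn_leq; apply/andP; split;
  by rewrite -ltnS -(@ltn_exp2l 2) // expnS; lia.
Qed.

Definition dyadic (R : realType) (s : seq bool) : set R :=
  [set x | (string_value s)%:R / 2 ^+ size s <= x <= (string_value s).+1%:R / 2 ^+ size s].
Arguments dyadic : clear implicits.

Lemma dyadicE (R : realType) s : dyadic R s =
  `[(string_value s)%:R / 2 ^+ size s, (string_value s).+1%:R / 2 ^+ size s]%classic.
Proof. by apply/seteqP; split => x; rewrite /dyadic /= in_itv. Qed.

Lemma dyadic_nilE (R : realType) (x : R) : dyadic R [::] x = (0 <= x <= 1) :> Prop.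
Proof. by rewrite /dyadic /= expr0 !divr1. Qed.

Lemma dyadic_rcons (R : realType) s b (x : R) :
  dyadic R (rcons s b) x -> dyadic R s x.
Proof.
rewrite /dyadic /= string_value_rcons size_rcons exprS -muln2.
have p0 : 0 < 2 ^+ size s :> R by rewrite exprn_gt0.
rewrite !ler_pdivrMr ?ler_pdivlMr ?mulr_gt0 // -!natr1 !natrD !natrM.
by case: b => /= /andP[h1 h2]; apply/andP; split; nra.
Qed.

Lemma dyadic_rcons_exists (R : realType) s (x : R) :
  dyadic R s x -> exists b, dyadic R (rcons s b) x.
Proof.
have d0 : 0 < 2 ^+ size s :> R by rewrite exprn_gt0.
rewrite {1}/dyadic /= ler_pdivrMr ?ler_pdivlMr // -[(string_value _).+1%:R]natr1 => /andP[h1 h2].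
have [h3|h3] := leP ((string_value s)%:R * 2 + 1) (x * (2 * 2 ^+ size s)).
- exists true; rewrite /dyadic /= string_value_rcons size_rcons exprS -muln2.
  rewrite ler_pdivrMr ?ler_pdivlMr ?mulr_gt0 // -[(_ + _).+1%:R]natr1 natrD natrM /=.
  by apply/andP; split; lra.
- exists false; rewrite /dyadic /= string_value_rcons size_rcons exprS -muln2.
  rewrite ler_pdivrMr ?ler_pdivlMr ?mulr_gt0 // -[(_ + _).+1%:R]natr1 natrD natrM /=.
  by apply/andP; split; lra.
Qed.

Lemma dyadic_mkseq_le (R : realType) (X : nat -> bool) m n (x : R) :
  (m <= n)%N -> dyadic R (mkseq X n) x -> dyadic R (mkseq X m) x.
Proof.
move=> /subnK <-; elim: (n - m)%N => [|k IH] //.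
by rewrite addSn mkseqS => /dyadic_rcons.
Qed.

Definition bin_sum (R : realType) (X : nat -> bool) (n : nat) : R :=
  \sum_(k < n) (X k)%:R / 2 ^+ k.+1.

Lemma bin_sumE (R : realType) X n :
  bin_sum R X n = (string_value (mkseq X n))%:R / 2 ^+ n.
Proof.
rewrite /bin_sum; elim: n => [|n IH]; first by rewrite big_ord0 mul0r.
rewrite big_ord_recr /= IH mkseqS string_value_rcons -muln2 natrD natrM exprS.
by field; rewrite expf_neq0.
Qed.

Lemma bin_sum_dyadic (R : realType) X n : dyadic R (mkseq X n) (bin_sum R X n).
Proof.
rewrite /dyadic /= size_mkseq bin_sumE lexx /=.
by rewrite ler_pM2r ?invr_gt0 ?exprn_gt0 // ler_nat.
Qed.

(** From rank [n] on, the partial sums lie in the closed dyadic interval of the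
    prefix of length [n], and so does their limit. *)
Lemma bin_val_dyadic (R : realType) X n : dyadic R (mkseq X n) (bin_val R X).
Proof.
have in_dyadic m : (n <= m)%N -> dyadic R (mkseq X n) (bin_sum R X m).
  by move=> nm; apply: dyadic_mkseq_le nm _; exact: bin_sum_dyadic.
have cv : cvgn (bin_sum R X).
  apply: nondecreasing_is_cvgn.
    apply/nondecreasing_seqP => k; rewrite /bin_sum big_ord_recr /= lerDl.
    by rewrite divr_ge0 // exprn_ge0.
  exists 1 => _ [k _ <-]; have := @dyadic_mkseq_le R X 0%N k _ (leq0n _) (bin_sum_dyadic R X k).
  by rewrite dyadic_nilE => /andP[].
rewrite /dyadic /=; apply/andP; split.
- by apply: limr_ge => //; exists n => // m /= /in_dyadic/andP[].
- by apply: limr_le => //; exists n => // m /= /in_dyadic/andP[].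
Qed.

Lemma bin_val_eq (R : realType) X (x : R) :
  (forall n, dyadic R (mkseq X n) x) -> bin_val R X = x.
Proof.
move=> xX; have dist n : `|bin_val R X - x| <= (2^-1) ^+ n.
  have /andP[] := xX n; have /andP[] := bin_val_dyadic R X n.
  rewrite size_mkseq -[(string_value _).+1%:R]natr1 mulrDl mul1r exprVn => h1 h2 h3 h4.
  by rewrite ler_norml; apply/andP; split; lra.
apply/eqP; rewrite -subr_eq0 -normr_le0.
have cv : (2^-1 : R) ^+ n @[n --> \oo] --> (0 : R) by apply: cvg_expr; rewrite ger0_norm; lra.
rewrite -(cvg_lim _ cv) //; apply: limr_ge; first by apply/cvg_ex; exists 0.
by exists 0%N => // n _ /=.
Qed.

(** For surjectivity, each closed dyadic interval containing [x] has a half that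
    contains [x]; choosing halves from [s] on gives an expansion of [x] which
    extends [s]. *)
Lemma bin_val_cylinder (R : realType) s :
  @bin_val R @` cylinder s = dyadic R s.
Proof.
apply/seteqP; split=> x; first by move=> [X sX <-]; rewrite -sX; exact: bin_val_dyadic.
move=> xs.
(* next t is the bit that selects a half of the interval of t containing x *)
have [next nextP] : {next : seq bool -> bool &
    forall t, dyadic R t x -> dyadic R (rcons t (next t)) x}.
  apply: (@choice (seq bool) bool (fun t b => dyadic R t x -> dyadic R (rcons t b) x)) => t.
  have [/dyadic_rcons_exists[b bP]|nt] := pselect (dyadic R t x); first by exists b.
  by exists true => /nt.
(* the prefixes of the expansion, each extending the previous one *)
pose t k := iter k (fun u => rcons u (next u)) s.
have tx k : dyadic R (t k) x by elim: k => [|k IH] //=; exact: nextP.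
have size_t k : size (t k) = (size s + k)%N.
  by elim: k => [|k IH]; rewrite ?addn0 //= size_rcons IH addnS.
pose X k := nth false (t k.+1) k.
have t_nth j k i : (i < size (t j))%N -> nth false (t (k + j)%N) i = nth false (t j) i.
  move=> ij; elim: k => [|k IH] //=; rewrite nth_rcons.
  by rewrite size_t (leq_trans (n := size (t j))) // size_t; lia.
have tX j : mkseq X (size (t j)) = t j.
  apply: (@eq_from_nth _ false); first by rewrite size_mkseq.
  move=> i; rewrite size_mkseq => ij; rewrite nth_mkseq // /X.
  by rewrite -(t_nth j i.+1) // -(t_nth i.+1 j) 1?addnC // size_t; lia.
exists X; first by rewrite /cylinder /= (tX 0%N).
apply: bin_val_eq => n; apply: (@dyadic_mkseq_le _ _ _ (size (t n))).
  by rewrite size_t; lia.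
by rewrite tX.
Qed.

Lemma bin_val_open_of (R : realType) (W : set (seq bool)) :
  @bin_val R @` open_of W = \bigcup_(s in W) dyadic R s.
Proof.
by rewrite image_bigcup; apply: eq_bigcupr => s _; exact: bin_val_cylinder.
Qed.

Lemma measurable_dyadics (R : realType) (W : set (seq bool)) :
  measurable (\bigcup_(s in W) dyadic R s).
Proof.
rewrite bigcup_mkcond; apply: countable_bigcupT_measurable => [|s].
  exact: countableP.
by case: ifP => _ //; rewrite dyadicE; exact: measurable_itv.
Qed.

(** * From left-c.e. randomness to 2-randomness *)

Lemma computable_rat_dyadic (N L : nat -> nat) :
  recursive set0 N -> recursive set0 L ->
  computable_rat (fun k => (N k)%:R / 2 ^+ (L k)).
Proof.
move=> NP LP; exists N, (fun=> 0%N), (fun k => (2 ^ L k).-1); split.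
- exact: NP.
- exact: (@recursive_const set0 nat nat 0%N).
- by change (recursive set0 (fun k => (2 ^ L k).-1)%N); recursive_tac.
- by move=> k; rewrite prednK ?expn_gt0 // subr0 natrX.
Qed.

(** The index of an interval codes (length, value, candidate witness); [rt] is the
    numerator of its right end and [lt] that of the approximation to its left
    end.  Indices whose value is too large for the length give the point 1. *)
Lemma left_ce_random_two_random (R : realType) (X : nat -> bool) :
  left_ce_random (bin_val R X) -> two_random R X.
Proof.
move=> rX U [W [/ce_in_zero_jump_Sigma2[D DP WD] UE muU]] XU.
have {}WD n s : W n s <-> exists u, forall t, D (pair_nat n (code_string s)) u t.
  rewrite -WD /=; split; first by exists n, s.
  by move=> [n' [s' [/pair_nat_inj[<- /code_string_inj <-]]]].
pose len i := fst_nat i; pose val i := fst_nat (snd_nat i).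
pose wit i := snd_nat (snd_nat i).
pose rt i := (if val i < 2 ^ len i then (val i).+1 else 2 ^ len i)%N.
pose ok n i t := D (pair_nat n (2 ^ len i + val i)%N) (wit i) t.
pose lt n i s := (if (val i < 2 ^ len i) && all (ok n i) (iota 0 s) then val i else rt i)%N.
pose inW n i := (val i < 2 ^ len i)%N /\ forall t, ok n i t.
pose a n i : R := (if `[< inW n i >] then val i else rt i)%:R / 2 ^+ len i.
pose b (n : nat) i : R := (rt i)%:R / 2 ^+ len i.
have ratrE m k : ratr (m%:R / 2 ^+ k : rat) = m%:R / 2 ^+ k :> R.
  by rewrite fmorph_div /= rmorphXn /= !ratr_nat.
have rt_le i : (rt i <= 2 ^ len i)%N by rewrite /rt; case: ifP.
have a_bounds n i : 0 <= a n i /\ a n i <= b n i /\ b n i <= 1.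
  rewrite /a /b ler_pM2r ?invr_gt0 ?exprn_gt0 // ler_nat; split.
    by rewrite divr_ge0 // exprn_ge0.
  rewrite ler_pdivrMr ?exprn_gt0 // mul1r -natrX ler_nat rt_le; split=> //.
  by case: asboolP => // -[vi _]; rewrite /rt vi.
pose V n := \bigcup_i `[a n i, b n i]%classic.
(* an index either names a cylinder enumerated in W n, and then its interval is
   the dyadic interval of that string, or its interval is a single point *)
have itv_dyadic n i s : size s = len i -> string_value s = val i -> inW n i ->
    `[a n i, b n i]%classic = dyadic R s.
  move=> sl sv iW; rewrite dyadicE sl sv /a /b asboolT // /rt.
  by case: iW => ->.
apply: (rX V); last first.
  move=> n _; have := XU n Logic.I; rewrite UE => -[s Ws sX].
  have [u uP] := (WD _ _).1 Ws.
  pose i := pair_nat (size s) (pair_nat (string_value s) u).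
  have [li vi wi] : [/\ len i = size s, val i = string_value s & wit i = u].
    by rewrite /len /val /wit /i !pair_natK.
  exists i => //; rewrite (itv_dyadic _ _ s) //.
    by rewrite -(bin_val_cylinder R s); exists X.
  split; first by rewrite li vi string_value_lt.
  by move=> t; rewrite /ok li vi wi -code_stringE; apply: uP.
pose Dy := range (fun p : nat * nat => p.1%:R / 2 ^+ p.2 : R).
have Dy_countable : countable Dy.
  by apply: (@sub_countable _ _ _ [set: nat * nat]); [exact: card_image_le|exact: countableP].
exists a, b; split => //.
- exists (fun n i s => (lt n i s)%:R / 2 ^+ len i).
    apply: computable_rat_dyadic; rewrite /lt /rt /ok /val /wit /len; last by recursive_tac.
    by recursive_tac.
  move=> n i; split.
    apply/nondecreasing_seqP => s; rewrite ler_pM2r ?invr_gt0 ?exprn_gt0 // ler_nat /lt.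
    have -> : iota 0 s.+1 = iota 0 s ++ [:: s] by rewrite -addn1 iotaD.
    rewrite all_cat /rt.
    by case: (val i < _)%N => //; case: (all _ (iota 0 s)); case: (all _ _).
  apply: cvg_near_cst; rewrite /a; case: asboolP => [[vi iP]|niP].
    near=> s; rewrite ratrE /lt vi /=.
    by have -> : all (ok n i) (iota 0 s) by apply/allP => t _; exact: iP.
  have [vi|vi] := boolP (val i < 2 ^ len i)%N; last first.
    by near=> s; rewrite ratrE /lt (negbTE vi).
  have [t /negP nt] : exists t, ~ ok n i t by apply/existsNP => iP; apply: niP.
  exists t.+1 => // s /= ts; rewrite ratrE /lt.
  case: ifP => // /andP[_ /allP/(_ t)]; rewrite mem_iota add0n (negbTE nt).
  by move=> /(_ ts).
- exists (fun _ i _ => (rt i)%:R / 2 ^+ len i).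
    by apply: computable_rat_dyadic; rewrite /rt /val /len; recursive_tac.
  move=> n i; split; first by move=> ? ? _.
  by apply: cvg_near_cst; near=> s; rewrite ratrE.
- move=> n; have mDy : measurable Dy by exact: countable_measurable.
  apply: (@le_trans _ _ (lebesgue_measure ((\bigcup_(s in W n) dyadic R s) `|` Dy))).
    apply: le_measure; rewrite ?inE.
    + by apply: bigcup_measurable => i _; exact: measurable_itv.
    + by apply: measurableU => //; exact: measurable_dyadics.
    move=> x [i _]; have [iW|niW] := pselect (inW n i).
      have [s sE] : exists s, code_string s = (2 ^ len i + val i)%N.
        by apply: code_string_surj; rewrite addn_gt0 expn_gt0.
      have [sl sv] := code_string_size iW.1 sE.
      rewrite (itv_dyadic _ _ _ sl sv iW) => xs; left; exists s => //.
      by apply/WD; exists (wit i) => t; rewrite sE; apply: iW.2.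
    rewrite /= in_itv /= /a asboolF // => /le_anti xE; right.
    by exists (rt i, len i); rewrite //= xE.
  have /le_trans := measureU2 (@lebesgue_measure R) (@measurable_dyadics R (W n)) mDy; apply.
  rewrite [X in (_ + X)%E]countable_lebesgue_measure0 // adde0.
  by rewrite -bin_val_open_of -UE; exact: muU.
Unshelve. all: by end_near. Qed.

(** * From 2-randomness to left-c.e. randomness *)

(** The thickened union exceeds the original one by the margins
    [a i - d i, a i] and [b i, b i + 2 * d i], of total length 3 * d i. *)
Lemma lebesgue_measure_thicken (R : realType) (a b d : nat -> R) (e : R) :
  (forall i, a i <= b i) -> (forall i, 0 <= d i) ->
  (forall i, 3 * d i <= e / (2 ^ i.+1)%:R) ->
  (lebesgue_measure (\bigcup_i `[(a i - d i)%R, (b i + 2 * d i)%R]%classic) <=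
   lebesgue_measure (\bigcup_i `[a i, b i]%classic) + e%:E)%E.
Proof.
move=> ab d0 de.
have e0 : 0 <= e.
  have := le_trans (mulr_ge0 _ (d0 0%N)) (de 0%N); rewrite ler0n => /(_ isT).
  by rewrite pmulr_lge0 // invr_gt0 ltr0n.
pose E i := `[(a i - d i)%R, a i]%classic `|` `[b i, (b i + 2 * d i)%R]%classic.
have mE i : measurable (E i) by apply: measurableU; exact: measurable_itv.
have mI : measurable (\bigcup_i `[a i, b i]%classic : set R).
  by apply: bigcup_measurable => i _; exact: measurable_itv.
have mUE : measurable (\bigcup_i E i) by apply: bigcup_measurable.
have muE i : (lebesgue_measure (E i) <= (e / (2 ^ i.+1)%:R)%:E)%E.
  have /le_trans : (lebesgue_measure (E i) <=
      lebesgue_measure `[(a i - d i)%R, a i]%classic +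
      lebesgue_measure `[b i, (b i + 2 * d i)%R]%classic)%E.
    by apply: measureU2; exact: measurable_itv.
  apply; rewrite !lebesgue_measure_itv /= !lte_fin.
  have := de i; have := d0 i; set g := e / _.
  by case: ltP => _; case: ltP => _; rewrite -?EFinB -?EFinD ?adde0 ?add0e lee_fin; lra.
have muUE : (lebesgue_measure (\bigcup_i E i) <= e%:E)%E.
  have /le_trans := @measure_sigma_subadditive _ _ _ (@lebesgue_measure R) _ E mE mUE
    (@subset_refl _ _).
  apply; apply: le_trans (epsilon_trick0 xpredT e0).
  by apply: lee_nneseries => i _ //; exact: muE.
apply: (@le_trans _ _ (lebesgue_measure ((\bigcup_i `[a i, b i]%classic) `|` \bigcup_i E i))).
  apply: le_measure; rewrite ?inE.
  - by apply: bigcup_measurable => i _; exact: measurable_itv.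
  - exact: measurableU.
  move=> x [i _ /=]; rewrite in_itv /= => /andP[ax xb].
  have [xa|xa] := leP x (a i); first by right; exists i => //; left; rewrite /= in_itv /= ax.
  have [bx|bx] := leP (b i) x; first by right; exists i => //; right; rewrite /= in_itv /= bx.
  by left; exists i => //; rewrite /= in_itv /= !ltW.
have /le_trans := measureU2 (@lebesgue_measure R) mI mUE; apply.
exact: leeD.
Qed.

(** Clearing denominators turns the comparison into one of natural numbers. *)
Lemma recursive_dyadic_lt A (q : nat -> nat -> nat -> rat) :
  computable_rat (fun k => q (fst_nat k) (fst_nat (snd_nat k)) (snd_nat (snd_nat k))) ->
  recursive A (fun p : (nat * (nat * nat)) * (nat * (nat * nat)) =>
    nat_of_bool ((p.1.1%:R - p.1.2.1%:R) / 2 ^+ p.1.2.2 < q p.2.1 p.2.2.1 p.2.2.2)).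
Proof.
move=> [p [m [d [pP mP dP qE]]]].
have {}pP : recursive A p by apply: recursive_oracle.
have {}mP : recursive A m by apply: recursive_oracle.
have {}dP : recursive A d by apply: recursive_oracle.
pose k (x : (nat * (nat * nat)) * (nat * (nat * nat))) :=
  pair_nat x.2.1 (pair_nat x.2.2.1 x.2.2.2).
have -> : (fun p : (nat * (nat * nat)) * (nat * (nat * nat)) =>
    nat_of_bool ((p.1.1%:R - p.1.2.1%:R) / 2 ^+ p.1.2.2 < q p.2.1 p.2.2.1 p.2.2.2)) =
  (fun x => nat_of_bool (x.1.1 * (d (k x)).+1 + m (k x) * 2 ^ x.1.2.2 <
     p (k x) * 2 ^ x.1.2.2 + x.1.2.1 * (d (k x)).+1)%N).
  apply/funext => -[[u [v L]] [n [i t]]] /=; congr nat_of_bool.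
  have := qE (pair_nat n (pair_nat i t)); rewrite !pair_natK => ->; rewrite /k /=.
  rewrite ltr_pdivrMr ?exprn_gt0 // mulrAC ltr_pdivlMr ?ltr0n //.
  rewrite -(ltr_nat rat) !natrD !natrM natrX !mulrBl.
  by apply/idP/idP => ?; lra.
by rewrite /k; recursive_tac.
Qed.

(** [left_of n v i t]: the approximation [t] to the right end of the interval [i]
    already lies to the right of (v - 1) / 2^L.  Testing against v / 2^L would
    lose intervals whose right end is exactly v / 2^L.  [right_of n v i t]: the
    approximation [t] to the left end already exceeds (v + 1) / 2^L. *)
Lemma two_random_left_ce_random (R : realType) (X : nat -> bool) :
  two_random R X -> left_ce_random (bin_val R X).
Proof.
move=> rX V [a [b [[qa qaP qa_lim] [qb qbP qb_lim] abP VE muV]]] XV.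
pose L n i := (n + i + 4)%N.
pose d n i : R := 2 ^- L n i.
have d0 n i : 0 < d n i by rewrite invr_gt0 exprn_gt0.
pose left_of (n v i t : nat) := (v%:R - 1%:R) / 2 ^+ L n i < qb n.+1 i t.
pose right_of (n v i t : nat) := (v.+1%:R - 0%:R) / 2 ^+ L n i < qa n.+1 i t.
pose meets n c i t := [&& (2 ^ L n i <= c)%N, (c < 2 ^ (L n i).+1)%N,
  left_of n (c - 2 ^ L n i)%N i t &
  ~~ `[< exists u, right_of n (c - 2 ^ L n i)%N i u >]].
have meetsP : recursive zero_jump (fun p : nat * (nat * nat) =>
    nat_of_bool (meets (fst_nat p.1) (snd_nat p.1) p.2.1 p.2.2)).
  have rightP : recursive zero_jump (fun p : nat * (nat * nat) =>
      nat_of_bool `[< exists u, right_of p.1 p.2.1 p.2.2 u >]).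
    apply: (@recursive_jump _ _ _ (fun (p : nat * (nat * nat)) u => right_of p.1 p.2.1 p.2.2 u)).
    have H := recursive_dyadic_lt set0 qaP.
    apply: (recursive_comp (g := fun p : (nat * (nat * nat)) * nat =>
      ((p.1.2.1.+1, (0%N, L p.1.1 p.1.2.2)), (p.1.1.+1, (p.1.2.2, p.2)))) H).
    by rewrite /L; recursive_tac.
  have leftP : recursive zero_jump (fun p : (nat * nat) * (nat * nat) =>
      nat_of_bool (left_of p.1.1 p.1.2 p.2.1 p.2.2)).
    have H := recursive_dyadic_lt zero_jump qbP.
    apply: (recursive_comp (g := fun p : (nat * nat) * (nat * nat) =>
      ((p.1.2, (1%N, L p.1.1 p.2.1)), (p.1.1.+1, (p.2.1, p.2.2)))) H).
    by rewrite /L; recursive_tac.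
  rewrite /meets; recursive_tac.
  - by rewrite /L; recursive_tac.
  - by rewrite /L; recursive_tac.
  - apply: (recursive_comp (g := fun p : nat * (nat * nat) =>
      ((fst_nat p.1, (snd_nat p.1 - 2 ^ L (fst_nat p.1) p.2.1)%N), (p.2.1, p.2.2))) leftP).
    by rewrite /L; recursive_tac.
  - apply: (recursive_comp (g := fun p : nat * (nat * nat) =>
      (fst_nat p.1, ((snd_nat p.1 - 2 ^ L (fst_nat p.1) p.2.1)%N, p.2.1))) rightP).
    by rewrite /L; recursive_tac.
pose W n := [set s | exists y : nat * nat, meets n (code_string s) y.1 y.2].
have ratr_mk v e k : ratr ((v%:R - e%:R) / 2 ^+ k : rat) = (v%:R - e%:R) / 2 ^+ k :> R.
  by rewrite fmorph_div rmorphB /= rmorphXn /= !ratr_nat.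
have qa_le n i t : ratr (qa n i t) <= a n i.
  have [inc lim] := qa_lim n i; rewrite -(cvg_lim _ lim) //.
  apply: nondecreasing_cvgn_le; last by apply/cvg_ex; exists (a n i).
  by move=> s u su; rewrite ler_rat; apply: inc.
have qb_le n i t : ratr (qb n i t) <= b n i.
  have [inc lim] := qb_lim n i; rewrite -(cvg_lim _ lim) //.
  apply: nondecreasing_cvgn_le; last by apply/cvg_ex; exists (b n i).
  by move=> s u su; rewrite ler_rat; apply: inc.
apply: (rX (fun n => open_of (W n))).
  exists W; split=> //.
    set S := [set k | _]; suff -> : S = [set k | exists y : nat * nat,
        meets (fst_nat k) (snd_nat k) y.1 y.2] by exact: ce_in_exists meetsP.
    apply/seteqP; split => k; first by move=> [n [s [-> [y yP]]]]; exists y; rewrite !pair_natK.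
    move=> [y yP]; exists (fst_nat k).
    have [s sE] : exists s, code_string s = snd_nat k.
      apply: code_string_surj; case/and4P: yP => + _ _ _.
      by apply: leq_trans; rewrite expn_gt0.
    by exists s; rewrite sE fst_snd_natK; split=> //; exists y; rewrite sE.
  move=> n; rewrite /mu_cantor bin_val_open_of.
  apply: (@le_trans _ _ (lebesgue_measure
      (\bigcup_i `[(a n.+1 i - d n i)%R, (b n.+1 i + 2 * d n i)%R]%classic))).
    apply: le_measure; rewrite ?inE.
    - exact: measurable_dyadics.
    - by apply: bigcup_measurable => i _; exact: measurable_itv.
    (* a selected dyadic interval stays within one step left of a, two right of b *)
    move=> x [s [[i t] /and4P[/= cl ch lt /asboolPn rt] sx]]; exists i => //=.
    have [sL sv] : size s = L n i /\ string_value s = (code_string s - 2 ^ L n i)%N.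
      by apply: code_string_size; [rewrite expnS in ch|]; lia.
    move: lt rt; rewrite -sv => lt rt.
    move: sx; rewrite /dyadic /= sL -[(string_value s).+1%:R]natr1 mulrDl mul1r.
    rewrite -/(d n i) => /andP[x1 x2].
    have {}lt : ((string_value s)%:R - 1) / 2 ^+ L n i < b n.+1 i.
      by apply: lt_le_trans (qb_le n.+1 i t); rewrite -(ratr_mk _ 1%N) ltr_rat.
    have {}rt : a n.+1 i <= (string_value s).+1%:R / 2 ^+ L n i.
      have [inc lim] := qa_lim n.+1 i; rewrite -(cvg_lim _ lim) //.
      apply: limr_le; first by apply/cvg_ex; exists (a n.+1 i).
      exists 0%N => // u _ /=; rewrite leNgt; apply/negP => ru; apply: rt; exists u.
      by rewrite /right_of -(ltr_rat R) ratr_mk subr0.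
    move: lt rt; rewrite -[(string_value s).+1%:R]natr1 mulrBl mulrDl !mul1r.
    rewrite -/(d n i) => lt rt.
    by rewrite in_itv /=; apply/andP; split; lra.
  apply: le_trans (lebesgue_measure_thicken (e := 2 ^- n.+1) _ _ _) _.
  - by move=> i; have [_ []] := abP n.+1 i.
  - by move=> i; exact: ltW.
  - move=> i; rewrite /d /L natrX -invfM -exprD.
    (* 3 * 2^-L = (3 / 4) * 2^-(n+1) * 2^-(i+1) *)
    have -> : (n + i + 4 = 2 + (n.+1 + i.+1))%N by lia.
    rewrite exprD invfM mulrA -[leRHS]mul1r ler_pM2r ?invr_gt0 ?exprn_gt0 //.
    by lra.
  - rewrite -VE; apply: (@le_trans _ _ ((2 ^- n.+1)%:E + (2 ^- n.+1)%:E)%E).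
      by apply: leeD => //; exact: muV.
    by rewrite -EFinD lee_fin exprS invfM; lra.
move=> n _; have := XV n.+1 Logic.I; rewrite VE => -[i _]; rewrite /= in_itv /= => /andP[ax xb].
(* if [a, b] contains the real, the prefix of length L is selected *)
pose s := mkseq X (L n i).
have sL : size s = L n i by rewrite size_mkseq.
exists s; last by rewrite /cylinder /= sL.
have := bin_val_dyadic R X (L n i); rewrite -/s /dyadic /= sL => /andP[x1 x2].
have [t tP] : exists t, left_of n (string_value s) i t.
  have [_ /cvgr_gt lim] := qb_lim n.+1 i.
  have [|t0 _ tP] := lim (((string_value s)%:R - 1%:R) / 2 ^+ L n i).
    by rewrite mulrBl; have := d0 n i; rewrite /d; lra.
  by exists t0; have := tP t0 (leqnn _); rewrite /= /left_of -ratr_mk ltr_rat.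
exists (i, t); rewrite /meets /= code_stringE sL addKn leq_addr tP expnS mul2n -addnn ltn_add2l.
rewrite -{1}sL string_value_lt /=; apply/asboolPn => -[u].
rewrite /right_of -(ltr_rat R) ratr_mk subr0 => /lt_le_trans/(_ (qa_le _ _ _)).
by lra.
Qed.

Theorem proposition5p16 (R : realType) (X : nat -> bool) :
  left_ce_random (bin_val R X) <-> two_random R X.
Proof.
split; first exact: left_ce_random_two_random.
exact: two_random_left_ce_random.
Qed.
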